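(* Let $k\ge 3$ and $r\ge 2$ be integers. Let $K_r$ be the $r\times r$ matrix whose $(p,q)$ entry is $\binom{k-2+q-p}{k-3}$ if $q\ge p$, $1$ if $q=p-1$, and $0$ if $q<p-1$. Let $x=(x_{r-1},x_{r-2},\ldots,x_{0})^{\top}$ be an eigenvector of $K_r$ associated to an eigenvalue $\lambda$. Then for all $i=1,\dots,r-1$, $$x_{i} = (-1)^{i}k_{i}(\lambda)x_{0},$$ where $k_{i}(\lambda)$ is the characteristic polynomial of the $i\times i$ matrix $K_{i}$.
   Context: The characteristic polynomial of an $i\times i$ matrix $K_i$ is $\det(K_i-\lambda I)$. The matrix $K_i$ is defined by the same entry formula with size $i$. The entries of $x$ are indexed in decreasing order, so $x_0$ is the last entry. *)

(* Defs.v *)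
From HB Require Import structures.
From mathcomp Require Import all_boot all_order all_algebra.
Set Implicit Arguments.
Unset Strict Implicit.
Unset Printing Implicit Defensive.
Import Order.TTheory GRing.Theory Num.Theory.
Local Open Scope ring_scope.

(* Rows and columns are numbered from 0 here; the entries depend only on      *)
(* q - p, so the formula is the same as with numbering from 1.                *)
Definition Kmx (F : pzRingType) (k r : nat) : 'M[F]_r :=
  \matrix_(p < r, q < r)
    (if (p <= q)%N then 'C((k - 2) + (q - p), k - 3)%:R
     else if q.+1 == p then 1
     else 0).

(* det (A - X I); the library's char_poly is det (X I - A).                   *)
Definition charp (F : comNzRingType) (n : nat) (A : 'M[F]_n) : {poly F} :=
  \det (map_mx polyC A - 'X%:M).

(* Right (column) eigenvectors; the library's eigenspace is for row vectors.  *)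
Definition eigenvector (F : fieldType) (n : nat) (A : 'M[F]_n) (lambda : F)
    (x : 'cV[F]_n) : Prop :=
  x != 0 /\ A *m x = lambda *: x.

(* The i-th entry of x = (x_(n-1), ..., x_1, x_0)^T, counted from the bottom. *)
Definition dec_entry (F : Type) (n : nat) (x : 'cV[F]_n) (i : 'I_n) : F :=
  x (rev_ord i) ord0.

(* Main.v *)
(* Let A = K_i - lambda I.  It is the lower right block of K_r - lambda I, so  *)
(* the eigenvector equation restricted to the last i rows reads                *)
(* A (x_(i-1), ..., x_0)^T = - x_i e_1.  Multiplying by adj A and comparing    *)
(* last entries gives det A * x_0 = - x_i * c, where the cofactor c of the     *)
(* upper right corner is (-1)^(i-1), its minor being upper unitriangular.      *)
Require Import Defs.
From HB Require Import structures.
From mathcomp Require Import all_boot all_order all_algebra.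
From mathcomp Require Import zify.
Set Implicit Arguments.
Unset Strict Implicit.
Unset Printing Implicit Defensive.
Import Order.TTheory GRing.Theory Num.Theory.
Local Open Scope ring_scope.

(** Cut [x] just below its entry x_i. Since the entries of [Kmx] depend only on q - p, the bottom
    rows form a system for K_i - lambda I in which x_i enters only through one subdiagonal 1
    ([Kmx_eigenvector_block]). The adjugate solves it for the last entry x_0 without dividing by the
    determinant ([hessenberg_last_entry]). *)

Lemma horner_charp (F : comNzRingType) (n : nat) (A : 'M[F]_n) (a : F) :
  (charp A).[a] = \det (A - a%:M).
Proof.
rewrite /charp -[_.[a]]/(horner_eval a _) -det_map_mx.
congr (\det _); apply/matrixP => p q.
rewrite !mxE rmorphB rmorphMn /= /horner_eval hornerX.
by rewrite hornerC.
Qed.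

Lemma cofactor_hessenberg (R : comNzRingType) (m : nat) (A : 'M[R]_m.+1) :
    (forall p q : 'I_m.+1, (q.+1 < p)%N -> A p q = 0) ->
    (forall p q : 'I_m.+1, q.+1 = p -> A p q = 1) ->
  cofactor A ord0 ord_max = (-1) ^+ m.
Proof.
(* Dropping row 0 and the last column moves the subdiagonal of ones onto the diagonal; the transpose
   is there because [det_trig] wants a lower triangular matrix. *)
move=> A0 A1; rewrite /cofactor add0n -det_tr det_trig.
  rewrite big1 ?mulr1 // => j _; rewrite !mxE A1 //.
  by rewrite lift0 lift_max.
apply/is_trig_mxP => p q lt_pq; rewrite !mxE A0 //.
by rewrite lift0 lift_max ltnS.
Qed.

Lemma hessenberg_last_entry (R : comNzRingType) (m : nat) (A : 'M[R]_m.+1)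
    (v : 'cV[R]_m.+1) (c : R) :
    (forall p q : 'I_m.+1, (q.+1 < p)%N -> A p q = 0) ->
    (forall p q : 'I_m.+1, q.+1 = p -> A p q = 1) ->
    A *m v = c *: delta_mx ord0 ord0 ->
  c = (-1) ^+ m * \det A * v ord_max ord0.
Proof.
move=> A0 A1 Av.
have /matrixP/(_ ord_max ord0) : \det A *: v = c *: (\adj A *m delta_mx ord0 ord0).
  by rewrite scalemxAr -Av mulmxA mul_adj_mx mul_scalar_mx.
rewrite -colE !mxE cofactor_hessenberg // -mulrA => ->.
by rewrite mulrCA -exprMn mulrNN mulr1 expr1n mulr1.
Qed.

Lemma Kmx_rshift (F : pzRingType) (k d m : nat) (p q : 'I_m) :
  Kmx F k (d + m) (rshift d p) (rshift d q) = Kmx F k m p q.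
Proof. by rewrite !mxE /= leq_add2l subnDl -addnS eqn_add2l. Qed.

(** Only the corner of this lower left block touches the subdiagonal. *)
Lemma Kmx_shift (F : pzRingType) (k d m : nat) (p : 'I_m) (q : 'I_d.+1) :
  Kmx F k (d.+1 + m) (rshift d.+1 p) (lshift m q) =
    ((p == 0 :> nat) && (q == ord_max))%:R.
Proof.
rewrite mxE /= -val_eqE /=; have := ltn_ord q => lt_qd.
rewrite ifF; last by lia.
by case: ifP => H; case: andP => //= H'; exfalso; lia.
Qed.

Lemma Kmx_eigenvector_block (F : fieldType) (k d m : nat) (lambda : F)
    (x : 'cV[F]_(d.+1 + m.+1)) :
    Kmx F k (d.+1 + m.+1) *m x = lambda *: x ->
  (Kmx F k m.+1 - lambda%:M) *m dsubmx x =
    - x (lshift m.+1 ord_max) ord0 *: delta_mx ord0 ord0.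
Proof.
move=> Kx; rewrite mulmxBl mul_scalar_mx; apply/matrixP => p j.
rewrite (ord1 j) {j}.
have /matrixP/(_ (rshift d.+1 p) ord0) := Kx.
rewrite !mxE big_split_ord /= => <-.
rewrite opprD addrCA -sumrB [X in _ + X]big1 => [|q _]; last first.
  by rewrite Kmx_rshift !mxE subrr.
rewrite addr0 mulNr; congr (- _).
rewrite (bigD1 ord_max) //= big1 ?addr0 => [|q /negPf nq].
  by rewrite Kmx_shift eqxx !andbT mulrC.
by rewrite Kmx_shift nq andbF mul0r.
Qed.

Theorem corollary2 (F : numFieldType) (k r : nat) (hk : (3 <= k)%N)
    (hr : (2 <= r)%N) (lambda : F) (x : 'cV[F]_r)
    (hx : eigenvector (Kmx F k r) lambda x) :
  forall i : 'I_r, (1 <= i)%N ->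
    dec_entry x i =
      (-1) ^+ i * (charp (Kmx F k i)).[lambda]
        * dec_entry x (Ordinal (ltnW hr)).
Proof.
move=> i; case Ei: (nat_of_ord i) => [//|m] _.
(* As i = m + 1 < r, the upper block is nonempty and x_i is its last entry. *)
have [d Er] : {d | r = (d.+1 + m.+1)%N}.
  by exists (r - m.+2)%N; have := ltn_ord i; lia.
subst r; have [_ /Kmx_eigenvector_block Ax] := hx.
rewrite horner_charp /dec_entry.
have -> : rev_ord i = lshift m.+1 ord_max.
  by apply: val_inj; rewrite /= Ei; lia.
have -> : rev_ord (Ordinal (ltnW hr)) = rshift d.+1 (ord_max : 'I_m.+1).
  by apply: val_inj => /=; lia.
have := hessenberg_last_entry _ _ Ax.
rewrite mxE exprS mulN1r !mulNr => <- //; first by rewrite opprK.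
(* Subtracting lambda I changes nothing below the diagonal. *)
- move=> p q lt_qp; rewrite !mxE -val_eqE /=.
  rewrite ifF; last by lia.
  rewrite ifF; last by lia.
  by rewrite gtn_eqF ?subr0 // ltnW.
- move=> p q Ep; rewrite !mxE -val_eqE /= -Ep.
  by rewrite ltnn eqxx gtn_eqF // subr0.
Qed.
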